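(* For every integer $m\ge1$, the fan poset $P=\mathcal V(3,2,\ldots,2)$, where there are $m+1$ entries equal to $2$, is $m$-L-bounded but not $(m-1)$-L-bounded.
   Context: All posets are finite and nonempty. Let $[n]=\{1,\dots,n\}$; families of subsets of $[n]$ are ordered by inclusion. A poset $(P,\le)$ contains a poset $(P',\le')$ as a (weak) subposet if there is an injection $f:P'\to P$ such that $u\le' v$ implies $f(u)\le f(v)$. A family $\mathcal F\subseteq 2^{[n]}$ is $P$-free if it does not contain $P$ in this sense. $e(P)$ is the maximum integer $k\ge 0$ such that for all integers $n$ and $s$ the family $\binom{[n]}{s}\cup\binom{[n]}{s+1}\cup\cdots\cup\binom{[n]}{s+k-1}$ is $P$-free, where $\binom{[n]}{j}$ is the collection of $j$-element subsets of $[n]$ (empty if $j<0$ or $j>n$). The Lubell function of $\mathcal F\subseteq 2^{[n]}$ is the average over all $n!$ full (maximal) chains $\mathcal C$ of $2^{[n]}$ of $|\mathcal F\cap\mathcal C|$; equivalently $\bar h_n(\mathcal F)=\sum_{F\in\mathcal F}1/\binom{n}{|F|}$. For an integer $m\ge0$, $P$ is $m$-L-bounded if for all $n$, $\bar h_n(\mathcal F)\le e(P)$ for every $P$-free family $\mathcal F$ of subsets of $[n]$ all of whose members have sizes in $[m,n-m]$. Let $\mathcal P_\ell$ denote the chain with $\ell$ elements. For $\ell_1\ge\cdots\ge\ell_k\ge2$, the fan $\mathcal V(\ell_1,\ldots,\ell_k)$ is the poset obtained from disjoint chains $\mathcal P_{\ell_1},\ldots,\mathcal P_{\ell_k}$ by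 identifying their minimum elements (elements of different chains other than the common minimum are incomparable). *)

(* Defs.v *)
From HB Require Import structures.
From mathcomp Require Import all_boot all_order all_fingroup all_algebra.
From mathcomp Require Import boolp.
(* Not imported: its set notations clash with those of finset. *)
From mathcomp Require classical_sets.

Set Implicit Arguments.
Unset Strict Implicit.
Unset Printing Implicit Defensive.

Import Order.TTheory GRing.Theory Num.Theory.

Local Open Scope nat_scope.

(* Subsets of [n] = {1, ..., n} are represented as {set 'I_n}. *)

Definition contains n (F : {set {set 'I_n}}) d (P : porderType d) : Prop :=
  exists f : P -> {set 'I_n},
    [/\ injective f, forall u, f u \in F &
        forall u v : P, (u <= v)%O -> f u \subset f v].

Definition poset_free d (P : porderType d) n (F : {set {set 'I_n}}) : Prop :=
  ~ contains F P.

Definition layer n (j : int) : {set {set 'I_n}} :=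
  [set A : {set 'I_n} | Posz #|A| == j].

Definition layers n (s : int) (k : nat) : {set {set 'I_n}} :=
  \bigcup_(i < k) layer n (s + Posz i)%R.

Definition layers_free d (P : porderType d) (k : nat) : Prop :=
  forall (n : nat) (s : int), poset_free P (layers n s k).

(* The default value 0 of xget is irrelevant for nonempty finite posets, where
   the maximum exists (see e_posetP). *)
Definition e_poset d (P : finPOrderType d) : nat :=
  classical_sets.xget 0 (fun k =>
    layers_free P k /\ forall k', layers_free P k' -> k' <= k).

Definition is_chain n (C : {set {set 'I_n}}) : bool :=
  [forall A in C, forall B in C, (A \subset B) || (B \subset A)].

Definition full_chains n : {set {set {set 'I_n}}} :=
  [set C | maxset (@is_chain n) C].

Definition lubell n (F : {set {set 'I_n}}) : rat :=
  ((\sum_(C in full_chains n) #|F :&: C|)%:R / #|full_chains n|%:R)%R.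

(* If n < m then the truncated n - m is 0 and no size satisfies both bounds. *)
Definition L_bounded d (P : finPOrderType d) (m : nat) : Prop :=
  forall (n : nat) (F : {set {set 'I_n}}),
    poset_free P F -> (forall A, A \in F -> m <= #|A| <= n - m) ->
    (lubell F <= (e_poset P)%:R)%R.

(* V(l_1, ..., l_k): None is the common minimum, and Some (Tagged _ j), with tag
   i, is the element of the i-th chain at height j.+1 above that minimum. *)
Definition fan (l : seq nat) : Type :=
  option {i : 'I_(size l) & 'I_(nth 0 l i).-1}.

HB.instance Definition _ l := Finite.on (fan l).

Section FanOrder.
Variable l : seq nat.

Definition fan_le (x y : fan l) : bool :=
  match x, y with
  | None, _ => true
  | Some _, None => false
  | Some u, Some v => (tag u == tag v) && (tagged u <= tagged v)
  end.

Fact fan_le_refl : reflexive fan_le.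
Proof. by case=> [u|] //=; rewrite eqxx leqnn. Qed.

Fact fan_le_anti : antisymmetric fan_le.
Proof.
case=> [[i j]|] [[i' j']|] //= /andP[/andP[/eqP ii' le1] /andP[_ le2]].
case: _ / ii' in j' le1 le2 *; congr (Some (Tagged _ _)).
by apply/val_inj/eqP; rewrite eqn_leq le1.
Qed.

Fact fan_le_trans : transitive fan_le.
Proof.
case=> [v|] [u|] [w|] //= /andP[/eqP uv le1] /andP[/eqP vw le2].
by rewrite (leq_trans le1 le2) uv vw eqxx.
Qed.

End FanOrder.

Fact fan_display : Order.disp_t. Proof. exact: Order.Disp tt tt. Qed.

HB.instance Definition _ l :=
  Order.Le_isPOrder.Build fan_display (fan l)
    (@fan_le_refl l) (@fan_le_anti l) (@fan_le_trans l).

Lemma layers_free0 d (P : finPOrderType d) : 0 < #|P| -> layers_free P 0.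
Proof.
move=> /card_gt0P[u _] n s [f [_ fF _]].
by have := fF u; rewrite /layers big_ord0 inE.
Qed.

Lemma layers_free_lt d (P : finPOrderType d) k : layers_free P k -> k < #|P|.
Proof.
move=> Pfree; rewrite ltnNge; apply/negP => leP.
apply: (Pfree #|P| 1%R); exists (fun u => enum_rank @: [set v : P | (v <= u)%O]).
split=> [u v /imset_inj-/(_ (@enum_rank_inj _))/setP eq_uv|u|u v le_uv].
- apply: le_anti; have := eq_uv u; have := eq_uv v.
  by rewrite !inE !lexx => -> <-.
- set D := [set v : P | (v <= u)%O].
  have D_gt0 : 0 < #|D| by apply/card_gt0P; exists u; rewrite inE.
  have ltD : #|D|.-1 < k by rewrite prednK // (leq_trans (max_card _)).
  apply/bigcupP; exists (Ordinal ltD) => //=.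
  by rewrite inE card_imset /=; [rewrite -PoszD add1n prednK | exact: enum_rank_inj].
- by apply/imsetS/subsetP => w; rewrite !inE => /le_trans->.
Qed.

Lemma e_posetP d (P : finPOrderType d) : 0 < #|P| ->
  layers_free P (e_poset P) /\ forall k, layers_free P k -> k <= e_poset P.
Proof.
move=> P_gt0.
apply: (@classical_sets.xgetPex _ 0 (fun k =>
  layers_free P k /\ forall k', layers_free P k' -> k' <= k)).
have exP : exists k, `[< layers_free P k >].
  by exists 0; apply/asboolP/layers_free0.
have ubP k : `[< layers_free P k >] -> k <= #|P|.
  by move=> /asboolP/layers_free_lt/ltnW.
have [k /asboolP Pk maxk] := ex_maxnP exP ubP.
by exists k; split=> // k' Pk'; apply/maxk/asboolP.
Qed.

Section Lubell.
Variable n : nat.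
Implicit Types (A B : {set 'I_n}) (C F : {set {set 'I_n}}).

Lemma is_chainP C :
  reflect {in C &, forall A B, (A \subset B) || (B \subset A)} (is_chain C).
Proof.
apply: (iffP forall_inP) => chC A; first by move=> B /chC/forall_inP; apply.
by move=> CA; apply/forall_inP => B CB; apply: chC.
Qed.

Lemma full_chain_mem C A : C \in full_chains n ->
  {in C, forall B, (A \subset B) || (B \subset A)} -> A \in C.
Proof.
rewrite inE => /maxsetP[/is_chainP chC maxC] cmpA.
rewrite -(maxC (A |: C)) ?setU11 ?subsetUr //.
apply/is_chainP => B D; rewrite !inE => /orP[/eqP->|CB] /orP[/eqP->|CD].
- by rewrite subxx.
- exact: cmpA.
- by rewrite orbC cmpA.
- exact: chC.
Qed.

Lemma full_chain_layer C k : C \in full_chains n -> k <= n ->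
  #|[set A in C | #|A| == k]| = 1.
Proof.
move=> fC le_kn; have chC : is_chain C by move: fC; rewrite inE => /maxsetp.
move/is_chainP in chC.
have C0 : set0 \in C by apply: full_chain_mem => // B _; rewrite sub0set.
have CT : setT \in C.
  by apply: full_chain_mem => // B _; rewrite subsetT orbT.
have szT : k <= #|[set: 'I_n]| by rewrite cardsT card_ord.
have [A /andP[CA leA] maxA] : {A | (A \in C) && (#|A| <= k) &
    forall B, B \in C -> #|B| <= k -> #|B| <= #|A|}.
  case: (@arg_maxnP _ set0 (fun B => (B \in C) && (#|B| <= k))
    (fun B => #|B|)) => [|A PA maxA]; first by rewrite C0 cards0.
  by exists A => // B CB leB; apply: maxA; rewrite CB.
have [B /andP[CB geB] minB] : {B | (B \in C) && (k <= #|B|) &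
    forall D, D \in C -> k <= #|D| -> #|B| <= #|D|}.
  case: (@arg_minnP _ setT (fun B => (B \in C) && (k <= #|B|))
    (fun B => #|B|)) => [|B PB minB]; first by rewrite CT.
  by exists B => // D CD leD; apply: minB; rewrite CD.
have subC D E : D \in C -> E \in C -> #|D| <= #|E| -> D \subset E.
  move=> CD CE leDE; case/orP: (chC D E CD CE) => // sED.
  by rewrite (_ : E = D) //; apply/eqP; rewrite eqEcard sED.
have [D /and3P[sAD sDB /eqP szD]] :
    exists D : {set 'I_n}, [&& A \subset D, D \subset B & #|D| == k].
  have sAB := subC A B CA CB (leq_trans leA geB).
  have : 0 < #|[set E : {set 'I_n} | E \subset B :\: A & #|E| == k - #|A|]|.
    by rewrite cards_draws bin_gt0 cardsDS // leq_sub2r.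
  case/card_gt0P=> E; rewrite inE subsetD => /andP[/andP[sEB dEA] /eqP szE].
  exists (A :|: E); rewrite subsetUl subUset sAB sEB /= cardsU szE.
  have/eqP-> : A :&: E == set0 by rewrite setI_eq0 disjoint_sym.
  by rewrite cards0 subn0 subnKC.
have CD : D \in C.
  apply: full_chain_mem => // E CE; case: (leqP #|E| k) => leE.
    by rewrite (subset_trans (subC E A CE CA (maxA E CE leE))) ?orbT.
  by rewrite (subset_trans sDB (subC B E CB CE (minB E CE (ltnW leE)))).
apply/eqP/cards1P; exists D; apply/setP => E; rewrite !inE.
apply/andP/eqP => [[CE /eqP szE]|->]; last by rewrite szD.
by apply/eqP; rewrite eqEcard subC ?szD ?szE ?leqnn.
Qed.

Lemma card_full_chains_gt0 : 0 < #|full_chains n|.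
Proof.
have : is_chain (set0 : {set {set 'I_n}}) by apply/is_chainP => A B; rewrite inE.
by move/maxset_exists=> [C fC _]; apply/card_gt0P; exists C; rewrite inE.
Qed.

Definition permC (s : {perm 'I_n}) C : {set {set 'I_n}} :=
  (fun A : {set 'I_n} => s @: A) @: C.

Lemma imset_perm_inj (s : {perm 'I_n}) :
  injective (fun A : {set 'I_n} => s @: A).
Proof. exact/imset_inj/perm_inj. Qed.

Lemma permCK (s : {perm 'I_n}) : cancel (permC s) (permC (s^-1)%g).
Proof.
move=> C; rewrite /permC -imset_comp -[RHS]imset_id; apply: eq_imset => A /=.
by rewrite -imset_comp -[RHS]imset_id; apply: eq_imset => x /=; rewrite permK.
Qed.

Lemma permC_chain (s : {perm 'I_n}) C : is_chain C -> is_chain (permC s C).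
Proof.
move/is_chainP=> chC; apply/is_chainP => _ _ /imsetP[A CA ->] /imsetP[B CB ->].
by case/orP: (chC A B CA CB) => sAB; rewrite (imsetS _ sAB) ?orbT.
Qed.

Lemma permC_full (s : {perm 'I_n}) C :
  C \in full_chains n -> permC s C \in full_chains n.
Proof.
rewrite !inE => /maxsetP[chC maxC]; apply/maxsetP; split=> [|D chD sCD].
  exact: permC_chain.
rewrite -(maxC _ (permC_chain s^-1 chD)); last first.
  by rewrite -{1}(permCK s C); apply: imsetS.
by have := permCK s^-1 D; rewrite invgK.
Qed.

Lemma perm_of_card A B : #|A| = #|B| -> exists s : {perm 'I_n}, s @: A = B.
Proof.
move=> eqAB.
have eqC : #|~: A| = #|~: B| by apply/(@addnI #|A|); rewrite {2}eqAB !cardsC.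
have szAB : size (enum A ++ enum (~: A)) = size (enum B ++ enum (~: B)).
  by rewrite !size_cat -!cardE eqAB eqC.
have memU (D : {set 'I_n}) x : x \in enum D ++ enum (~: D).
  by rewrite mem_cat !mem_enum inE orbN.
have uniqU (D : {set 'I_n}) : uniq (enum D ++ enum (~: D)).
  rewrite cat_uniq !enum_uniq andbT /=; apply/hasPn => x.
  by rewrite !mem_enum inE.
pose f x := nth x (enum B ++ enum (~: B)) (index x (enum A ++ enum (~: A))).
have injf : injective f.
  move=> x y; rewrite /f (set_nth_default y) -?szAB ?index_mem ?memU // => /eqP.
  rewrite nth_uniq -?szAB ?index_mem ?memU // => /eqP eq_i.
  by rewrite -(nth_index x (memU A x)) eq_i nth_index.
exists (perm injf); apply/eqP; rewrite eqEcard card_imset; last exact: perm_inj.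
rewrite eqAB leqnn andbT; apply/subsetP => _ /imsetP[x Ax ->].
rewrite permE /f index_cat mem_enum Ax nth_cat -cardE -eqAB cardE.
have ltx : index x (enum A) < size (enum A) by rewrite index_mem mem_enum.
by rewrite ltx -mem_enum mem_nth // -cardE -eqAB cardE.
Qed.

Lemma card_full_chains_mem A :
  #|[set C in full_chains n | A \in C]| * 'C(n, #|A|) = #|full_chains n|.
Proof.
pose N B := #|[set C in full_chains n | B \in C]|.
have leN (B D : {set 'I_n}) : #|B| = #|D| -> N B <= N D.
  case/perm_of_card=> s sBD; rewrite /N -(card_imset _ (can_inj (permCK s))).
  apply/subset_leq_card/subsetP => _ /imsetP[C fC ->]; move: fC.
  by rewrite in_set => /andP[fC CB]; rewrite in_set permC_full // -sBD imset_f.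
have szA : #|A| <= n by rewrite -[leqRHS]card_ord max_card.
transitivity (\sum_(B : {set 'I_n} | #|B| == #|A|) N B).
  rewrite (eq_bigr (fun=> N A)) => [|B /eqP szB]; last first.
    by apply/eqP; rewrite eqn_leq !leN.
  have := card_draws 'I_n #|A|; rewrite card_ord => <-.
  rewrite sum_nat_const mulnC; congr (_ * _).
  by apply: eq_card => B; rewrite !inE.
under eq_bigr => B _.
  rewrite /N -sum1_card.
  under eq_bigl => C do rewrite inE.
  rewrite big_mkcondr; over.
rewrite exchange_big /= -[RHS]sum1_card; apply: eq_bigr => C fC.
rewrite -big_mkcondr /= sum1_card -(full_chain_layer fC szA).
by apply: eq_card => B; rewrite inE andbC.
Qed.

Lemma lubellE F : lubell F = (\sum_(A in F) 'C(n, #|A|)%:R^-1)%R.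
Proof.
rewrite /lubell; have -> : \sum_(C in full_chains n) #|F :&: C| =
    \sum_(A in F) #|[set C in full_chains n | A \in C]|.
  under eq_bigr => C _.
    rewrite -sum1_card; under eq_bigl => A do rewrite inE.
    rewrite big_mkcondr; over.
  rewrite exchange_big /=; apply: eq_bigr => A _.
  by rewrite -big_mkcondr sum1_card /=; apply: eq_card => C; rewrite inE.
rewrite natr_sum mulr_suml; apply: eq_bigr => A _.
have := card_full_chains_gt0; rewrite -(card_full_chains_mem A) muln_gt0.
case/andP=> N_gt0 B_gt0; rewrite natrM invfM mulrA mulfV ?mul1r //.
by rewrite pnatr_eq0 -lt0n.
Qed.

End Lubell.

(* Main.v *)
(* A family contains V(3,2,...,2) iff above one of its members A there are at
   least m+3 others that do not form an antichain; in particular e(P) = 2.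
   For the upper bound, classify the full chains by the least member A of the
   family they meet. If the members strictly above A form an antichain, such a
   chain meets at most one of them. Otherwise there are at most m+2 of them, with
   m+2 <= N := n - |A| since sizes are at most n - m, and by symmetry under the
   permutations fixing A pointwise each of them lies on a fraction
   1/C(N,k) <= 1/N of these chains. Either way the average is at most 1 + 1.
   When sizes may reach n - m + 1, take n = 2m: the layers m-1 and m plus a single
   (m+1)-set form a free family with Lubell function greater than 2, since an
   (m-1)-set has only m+1 supersets of size m. *)
Require Import Defs.
From mathcomp Require Import all_boot all_order all_algebra.
From mathcomp Require Import all_fingroup zify.

Set Implicit Arguments.
Unset Strict Implicit.
Unset Printing Implicit Defensive.

Import Order.TTheory GRing.Theory Num.Theory.

(** In the inductive step Pascal's rule gives one summand at least [n] and another at least 1. *)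
Lemma leq_bin n k : 0 < k < n -> n <= 'C(n, k).
Proof.
elim: n k => [|n IHn] [|k] //; rewrite ltnS => /= lt_kn.
case: k lt_kn => [|k] lt_kn; first by rewrite bin1.
rewrite binS -addn1 addnC leq_add ?bin_gt0 // IHn //.
Qed.

(** * Fans above a member of a family *)

Section UpSets.
Variables (n : nat) (F : {set {set 'I_n}}).
Implicit Types A B D : {set 'I_n}.

Definition above A := [set B in F | A \proper B].

(** The long chain goes to [A], [B], [D], and the tops of the short chains to other members above
    [A]; weak containment tolerates extra inclusions among these. *)
Lemma contains_fan m A B D : A \in F -> B \in above A -> D \in above A ->
  B \proper D -> m + 3 <= #|above A| -> contains F (fan (3 :: nseq m.+1 2)).
Proof.
move=> FA UB UD sBD leU.
pose s := enum (above A :\ B :\ D).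
have szs : m < size s.
  have nDB : D != B by apply: contraTneq sBD => ->; rewrite properxx.
  move: leU; rewrite -cardE (cardsD1 B) UB (cardsD1 D (_ :\ _)) !inE nDB.
  move: UD; rewrite inE => ->. by rewrite /= !add1n addn3 !ltnS.
pose l := 3 :: nseq m.+1 2.
have szl : size l = m.+2 by rewrite /= size_nseq.
(* Tag 0 is the long chain. The default [A] of [nth] is never reached, since
   [(tag u).-1 < size s]. *)
pose f (x : fan l) := if x is Some u then
  if tag u == 0 :> nat then if tagged u == 0 :> nat then B else D
  else nth A s (tag u).-1 else A.
have tag_lt (u : {i : 'I_(size l) & 'I_(nth 0 l i).-1}) : tag u < m.+2.
  by rewrite -szl.
have tagged_lt (u : {i : 'I_(size l) & 'I_(nth 0 l i).-1}) :
    tagged u < if tag u == 0 :> nat then 2 else 1.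
  case: u => -[[|i] lti] [j ltj] //=; move: ltj.
  by rewrite [nth _ _ _]nth_nseq; case: ifP.
have mem_s (u : {i : 'I_(size l) & 'I_(nth 0 l i).-1}) :
      tag u != 0 :> nat -> nth A s (tag u).-1 \in above A :\ B :\ D.
  move=> u0; rewrite -mem_enum mem_nth // (leq_trans _ szs) //.
  by have := tag_lt u; lia.
have fU u : f (Some u) \in above A.
  rewrite /f; case: eqP => [_|/eqP u0]; first by case: ifP.
  by have := mem_s _ u0; rewrite !inE => /and3P[_ _].
exists f; split=> [x y|[u|] //|[u|] [v|] //].
- have fA u : f (Some u) <> A.
    by move=> fuA; have := fU u; rewrite fuA inE properxx andbF.
  have uniq_s : uniq s by apply: enum_uniq.
  case: x y => [u|] [v|] // => [fuv|/fA|/esym/fA] //.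
  (* The type of the height depends on the tag, so both are compared as natural numbers. *)
  suff [eq_t eq_v] : tag u = tag v :> nat /\ tagged u = tagged v :> nat.
    case: u v eq_t eq_v {fuv} => [i j] [i' j'] /= /val_inj eq_i.
    by case: _ / eq_i in j' *; move=> /val_inj->.
  have := tagged_lt u; have := tagged_lt v; move: fuv; rewrite /f.
  case: (tag u =P 0 :> nat) => [u0|/eqP u0];
    case: (tag v =P 0 :> nat) => [v0|/eqP v0].
  + move=> fuv ltv ltu; split; first by rewrite u0 v0.
    have nBD : B <> D by move=> eBD; rewrite eBD properxx in sBD.
    move: fuv ltv ltu.
    move: (nat_of_ord (tagged u)) (nat_of_ord (tagged v)) => a b.
    by case: a b => [|[|a]] [|[|b]] //= e _ _; case: nBD.
  + by have := mem_s _ v0; rewrite !inE => /and3P[nD nB _]; case: ifP => _ e;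
      move: nD nB; rewrite -e eqxx.
  + by have := mem_s _ u0; rewrite !inE => /and3P[nD nB _]; case: ifP => _ e;
      move: nD nB; rewrite e eqxx.
  + have lts (w : {i : 'I_(size l) & 'I_(nth 0 l i).-1}) :
        tag w != 0 :> nat -> (tag w).-1 < size s.
      by move=> w0; rewrite (leq_trans _ szs) //; have := tag_lt w; lia.
    move/eqP; rewrite nth_uniq ?lts // => /eqP eq_t.
    rewrite !ltnS !leqn0 => /eqP-> /eqP->; split=> //.
    by rewrite -(prednK (n := tag u)) ?lt0n // eq_t prednK ?lt0n.
- by have := fU u; rewrite inE => /andP[].
- case/andP=> /eqP eq_t le_uv; rewrite /f.
  case: (tag u =P 0 :> nat) => u0; case: (tag v =P 0 :> nat) => v0.
  + move: le_uv; case: eqP => [_|/eqP u1]; case: eqP => // v1.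
      by rewrite proper_sub.
    by rewrite v1 leqn0 (negPf u1).
  + by case: v0; rewrite -eq_t.
  + by case: u0; rewrite eq_t.
  + by rewrite eq_t.
- by move=> _; have := fU v; rewrite inE => /andP[_ /proper_sub].
Qed.

(** An injective monotone map is strictly monotone, so all nonminimal points of the fan land
    strictly above the image of the minimum. *)
Lemma fan_contained m : contains F (fan (3 :: nseq m.+1 2)) ->
  exists A B D, [/\ A \in F, B \in above A, D \in above A, B \proper D &
                    m + 3 <= #|above A|].
Proof.
set l := 3 :: _ => -[f [injf fF lef]].
have ltf x y : (x < y)%O -> f x \proper f y.
  move=> lt_xy; rewrite properEneq lef ?Order.POrderTheory.ltW // andbT.
  by rewrite (inj_eq injf) (Order.POrderTheory.lt_eqF lt_xy).
have ltN u : f None \proper f (Some u) by apply: ltf.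
have fU u : f (Some u) \in above (f None) by rewrite inE fF ltN.
pose t k (ltk : k < 2) : fan l :=
  Some (Tagged (fun i : 'I_(size l) => 'I_(nth 0 l i).-1)
    (Ordinal ltk : 'I_(nth 0 l (@Ordinal (size l) 0 isT)).-1)).
exists (f None), (f (@t 0 isT)), (f (@t 1 isT)); split; rewrite ?fU ?fF //.
  by apply: ltf.
(* Two nonminimal points on the long chain and one on each of the [m + 1] short ones. *)
have -> : m + 3 = #|{: {i : 'I_(size l) & 'I_(nth 0 l i).-1}}|.
  rewrite card_tagged sumnE big_map big_enum /=.
  under eq_bigr => i _ do rewrite card_ord.
  transitivity (\sum_(x <- l) x.-1); last by rewrite (big_nth 0) big_mkord.
  by rewrite !big_cons big_nseq iter_addn; lia.
rewrite -(card_imset _ (inj_comp injf (@Some_inj _))).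
by apply/subset_leq_card/subsetP => _ /imsetP[u _ ->]; apply: fU.
Qed.

End UpSets.

(** * Full chains classified by the least member of the family they meet *)

Section MinChains.
Variables (n : nat) (F : {set {set 'I_n}}).
Implicit Types (A B D : {set 'I_n}) (C : {set {set 'I_n}}).

Lemma full_chain_total C : C \in full_chains n ->
  {in C &, forall A B, (A \subset B) || (B \subset A)}.
Proof. by rewrite inE => /maxsetp/is_chainP. Qed.

(** Induction on [#|B :\: D|]: swapping a point of [B :\: D] with one of [D :\: B] lowers it by one
    and fixes [A] pointwise. *)
Lemma perm_fix_of_card A B D : A \subset B -> A \subset D -> #|B| = #|D| ->
  exists s : {perm 'I_n}, perm_on (~: A) s /\ s @: B = D.
Proof.
move: {2}#|B :\: D| (erefl #|B :\: D|) => k; elim: k B => [|k IHk] B.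
  move=> /cards0_eq/eqP; rewrite setD_eq0 => sBD _ _ eqBD.
  exists 1%g; split; first exact: perm_on1.
  rewrite (_ : D = B); last by apply/esym/eqP; rewrite eqEcard sBD eqBD /=.
  by rewrite -[RHS]imset_id; apply: eq_imset => x; rewrite perm1.
move=> kBD sAB sAD eqBD.
have kDB : #|D :\: B| = k.+1.
  rewrite -kBD; apply/(@addnI #|B :&: D|).
  by rewrite cardsID setIC cardsID eqBD.
have /card_gt0P[x] : 0 < #|B :\: D| by rewrite kBD.
have /card_gt0P[y] : 0 < #|D :\: B| by rewrite kDB.
rewrite !inE => /andP[nBy Dy] /andP[nDx Bx].
have memT B' z : (z \in tperm x y @: B') = (tperm x y z \in B').
  by rewrite -{1}[z](tpermK x y) (mem_imset _ _ (@perm_inj _ _)).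
have fixA z : z \in A -> tperm x y z = z.
  move=> Az; apply: tpermD.
    by apply: contraTneq Az => <-; apply: contra nDx; apply: (subsetP sAD).
  by apply: contraTneq Az => <-; apply: contra nBy; apply: (subsetP sAB).
have [||| |s [sA sD]] := IHk (tperm x y @: B).
- apply/eqP; rewrite -eqSS -kBD (cardsD1 x (B :\: D)) !inE nDx Bx add1n eqSS.
  apply/eqP/eq_card => z; rewrite inE memT !inE.
  by case: tpermP => [->|->|/eqP/negPf-> _] //; rewrite ?eqxx ?Dy ?(negPf nBy) ?andbF.
- by apply/subsetP => z Az; rewrite memT fixA // (subsetP sAB).
- by [].
- by rewrite card_imset //; apply: perm_inj.
exists (tperm x y * s)%g; split.
  apply: perm_onM sA; apply/subsetP => z; rewrite !inE; apply: contra => Az.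
  by rewrite fixA.
by rewrite -sD -imset_comp; apply: eq_imset => z; rewrite /= permM.
Qed.

(** For [A] in [F] these classes are pairwise disjoint and together cover exactly the full chains
    that meet [F]. *)
Definition min_chains A := [set C in full_chains n |
  (A \in C) && [forall B in F :&: C, A \subset B]].

(** [F] may move under [s], but images of sets containing [A] still contain [A], while subsets of
    [A] are fixed, so minimality on [C] applies to them. *)
Lemma perm_min_chains (s : {perm 'I_n}) A C :
  perm_on (~: A) s -> C \in min_chains A -> permC s C \in min_chains A.
Proof.
move=> sA.
have fixA B : B \subset A -> s @: B = B.
  move=> sBA; rewrite -[RHS]imset_id; apply: eq_in_imset => x Bx.
  by rewrite (out_perm sA) // inE negbK (subsetP sBA).
rewrite in_set => /and3P[fC CA /forall_inP minA].
rewrite in_set permC_full //= -{1}(fixA A) // imset_f //=.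
apply/forall_inP => B0 /setIP[FB /imsetP[B CB eB]]; rewrite {B0}eB in FB *.
have [sAB|sBA] := orP (full_chain_total fC CA CB).
  by rewrite -(fixA A) // imsetS.
by move: FB; rewrite fixA // => FB; rewrite minA // inE FB.
Qed.

(** Double counting: by symmetry each superset of [A] of size [#|B|] lies on at least as many chains
    of the class as [B], and each chain has only one set of that size. *)
Lemma leq_card_min_chains A B : A \subset B ->
  #|[set C in min_chains A | B \in C]| * 'C(n - #|A|, #|B| - #|A|)
    <= #|min_chains A|.
Proof.
move=> sAB; pose N D := #|[set C in min_chains A | D \in C]|.
have leN D : A \subset D -> #|B| = #|D| -> N B <= N D.
  move=> sAD /(perm_fix_of_card sAB sAD)[s [sA sBD]].
  rewrite /N -(card_imset _ (can_inj (permCK s))).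
  apply/subset_leq_card/subsetP => _ /imsetP[C + ->].
  by rewrite in_set => /andP[mC CB]; rewrite in_set perm_min_chains // -sBD imset_f.
(* These supersets are parametrised as [A :|: X] with [X] disjoint from [A]. *)
pose E := [set X : {set 'I_n} | X \subset ~: A & #|X| == #|B| - #|A|].
have E_A X : X \in E -> (A :|: X) :\: A = X.
  rewrite inE => /andP[sXA _]; rewrite setDUl setDv set0U.
  by apply/setDidPl; rewrite disjoints_subset.
have szE X : X \in E -> #|A :|: X| = #|B|.
  move=> EX; have := cardsDS (subsetUl A X); rewrite E_A //.
  move: EX; rewrite inE => /andP[_ /eqP->].
  have := subset_leq_card sAB; have := subset_leq_card (subsetUl A X); lia.
have -> : 'C(n - #|A|, #|B| - #|A|) = #|E|.
  by rewrite cards_draws (cardsCs (~: A)) setCK card_ord.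
rewrite mulnC -sum_nat_const.
apply: (@leq_trans (\sum_(X in E) N (A :|: X))).
  by apply: leq_sum => X EX; rewrite leN ?subsetUl ?szE.
under eq_bigr => X _.
  rewrite /N -sum1_card; under eq_bigl => C do rewrite inE.
  rewrite big_mkcondr; over.
rewrite exchange_big /= -[leqRHS]sum1_card; apply: leq_sum => C.
rewrite inE => /and3P[fC _ _]; rewrite -big_mkcondr /= sum1_card.
have szB : #|B| <= n by rewrite -[leqRHS]card_ord max_card.
rewrite -(full_chain_layer fC szB).
rewrite -(@card_in_imset _ _ (fun X => A :|: X)); last first.
  move=> X Y /andP[EX _] /andP[EY _] /= eXY.
  by rewrite -(E_A _ EX) eXY E_A.
apply/subset_leq_card/subsetP => _ /imsetP[X /andP[EX CX] ->].
by rewrite inE /= CX szE ?eqxx.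
Qed.

(** Summing over classes counts a chain once if it meets [F]; the other chains add nothing on the
    left. *)
Lemma sum_full_chains_min :
  (forall A, A \in F ->
     \sum_(C in min_chains A) #|F :&: C| <= 2 * #|min_chains A|) ->
  \sum_(C in full_chains n) #|F :&: C| <= 2 * #|full_chains n|.
Proof.
move=> leF; pose M C := [set A in F | C \in min_chains A].
have M1 C : #|M C| <= 1.
  apply/card_le1_eqP => A B; rewrite !inE.
  move=> /and4P[FA _ CA /forall_inP mA] /and4P[FB _ CB /forall_inP mB].
  by apply/eqP; rewrite eqEsubset mA ?mB // inE ?FA ?FB.
have exchM (g : {set {set 'I_n}} -> nat) :
    \sum_(A in F) \sum_(C in min_chains A) g C =
    \sum_(C in full_chains n) #|M C| * g C.
  rewrite (exchange_big_dep (mem (full_chains n))) /=; last first.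
    by move=> A C _; rewrite inE => /andP[].
  apply: eq_bigr => C _; rewrite sum_nat_const; congr (_ * _).
  by apply: eq_card => A; rewrite [RHS]inE.
apply: (@leq_trans (\sum_(A in F) \sum_(C in min_chains A) #|F :&: C|)).
  rewrite exchM; apply: leq_sum => C fC.
  have [->|/set0Pn[A0 FCA0]] := eqVneq (F :&: C) set0; first by rewrite cards0.
  (* On a chain, a member of smallest size is the least one. *)
  case: (@arg_minnP _ A0 (mem (F :&: C)) (fun A => #|A|) FCA0) => A.
  move=> /setIP[FA CA] minA; rewrite -[leqLHS]mul1n leq_mul2r; apply/orP; right.
  apply/card_gt0P; exists A; rewrite inE FA in_set fC CA /=.
  apply/forall_inP => B FCB; have /setIP[_ CB] := FCB.
  case/orP: (full_chain_total fC CA CB) => // sBA.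
  by rewrite (_ : B = A) //; apply/eqP; rewrite eqEcard sBA minA.
apply: (@leq_trans (\sum_(A in F) 2 * #|min_chains A|)); first exact: leq_sum.
rewrite -big_distrr leq_mul2l /=.
under eq_bigr => A _ do rewrite -sum1_card.
rewrite exchM -sum1_card; apply: leq_sum => C _.
by rewrite muln1.
Qed.

End MinChains.

(** * The upper bound on the Lubell function *)

Lemma sum_min_chains_le m n (F : {set {set 'I_n}}) A :
  poset_free (fan (3 :: nseq m.+1 2)) F ->
  (forall B, B \in F -> #|B| <= n - m) -> 0 < m -> A \in F ->
  \sum_(C in min_chains F A) #|F :&: C| <= 2 * #|min_chains F A|.
Proof.
move=> freeF szF m_gt0 FA; set S := min_chains F A.
have leFC C : C \in S -> #|F :&: C| <= 1 + #|above F A :&: C|.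
  rewrite inE => /and3P[_ _ /forall_inP minA].
  apply: (@leq_trans #|A |: (above F A :&: C)|); last by rewrite cardsU1 leq_add2r leq_b1.
  apply/subset_leq_card/subsetP => B FCB; have := FCB; rewrite !inE => /andP[-> ->].
  by rewrite properEneq minA // eq_sym !andbT orbN.
(* [A] contributes one to each chain of its class, so the members above it may contribute one on
   average. *)
suff leU : \sum_(C in S) #|above F A :&: C| <= #|S|.
  apply: (@leq_trans (\sum_(C in S) (1 + #|above F A :&: C|))).
    exact: leq_sum.
  by rewrite big_split /= sum1_card mul2n -addnn leq_add2l.
case: (boolP [exists B in above F A, exists D in above F A, B \proper D]).
  case/exists_inP => B UB /exists_inP[D UD sBD].
  have ltU : #|above F A| <= m + 2.
    rewrite -ltnS -addnS leqNgt; apply/negP => leU.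
    by apply: freeF; apply: (contains_fan FA UB UD sBD).
  have sz_above E : E \in above F A -> #|A| < #|E| <= n - m.
    by rewrite inE => /andP[FE /proper_card->]; rewrite szF.
  have leN E : E \in above F A ->
      #|[set C in S | E \in C]| * (n - #|A|) <= #|S|.
    move=> UE; have /andP[ltAE leE] := sz_above E UE.
    apply: leq_trans (leq_card_min_chains F (B := E) _); last first.
      by move: UE; rewrite inE => /andP[_ /proper_sub].
    (* As [0 < m], [E] is not the whole ground set, where the binomial coefficient would be 1. *)
    rewrite leq_mul2l; apply/orP; right; apply: leq_bin; lia.
  (* From [#|A| + 2 <= #|D| <= n - m]. *)
  have ltN : m + 2 <= n - #|A|.
    have := proper_card sBD; have := sz_above B UB; have := sz_above D UD; lia.
  rewrite -(leq_pmul2r (m := n - #|A|)); last lia.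
  apply: (@leq_trans (#|above F A| * #|S|)); last first.
    by rewrite mulnC leq_mul2l (leq_trans ltU) ?orbT.
  have -> : \sum_(C in S) #|above F A :&: C| =
      \sum_(E in above F A) #|[set C in S | E \in C]|.
    under eq_bigr => C _.
      rewrite -sum1_card; under eq_bigl => E do rewrite in_setI.
      rewrite big_mkcondr; over.
    rewrite exchange_big /=; apply: eq_bigr => E _.
    by rewrite -big_mkcondr sum1_card /=; apply: eq_card => C; rewrite [RHS]inE.
  rewrite big_distrl -sum_nat_const /=; exact: leq_sum.
(* Now the members above [A] form an antichain. *)
rewrite -[leqRHS]sum1_card => /exists_inPn nex.
apply: leq_sum => C; rewrite inE => /andP[fC _].
apply/card_le1_eqP => B D /setIP[UB CB] /setIP[UD CD].
have nlt X Y : X \in above F A -> Y \in above F A -> X \subset Y -> X = Y.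
  move=> UX UY sXY; apply/eqP; move/exists_inPn: (nex X UX) => /(_ Y UY).
  by rewrite properEneq sXY andbT negbK.
by case/orP: (full_chain_total fC CB CD) => [/(nlt _ _ UB UD)|/(nlt _ _ UD UB)].
Qed.

Lemma lubell_le2 m n (F : {set {set 'I_n}}) : 0 < m ->
  poset_free (fan (3 :: nseq m.+1 2)) F ->
  (forall B, B \in F -> #|B| <= n - m) -> (lubell F <= 2%:R)%R.
Proof.
move=> m_gt0 freeF szF; rewrite /lubell.
rewrite ler_pdivrMr ?ltr0n ?card_full_chains_gt0 // -natrM ler_nat.
by apply: sum_full_chains_min => A; apply: sum_min_chains_le freeF szF m_gt0.
Qed.

(** * The value of e(P) *)

(** Two consecutive layers hold no chain of three sets. On [m + 3] points, layers 0, 1 and 2 contain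
    the fan: [m + 3] singletons and a pair lie above the empty set. *)
Lemma e_fan m : e_poset (fan (3 :: nseq m.+1 2)) = 2.
Proof.
set P := fan _.
have P_gt0 : 0 < #|{: P}| by apply/card_gt0P; exists None.
have [freeP maxP] := e_posetP P_gt0; apply/eqP; rewrite eqn_leq; apply/andP; split.
  rewrite leqNgt; apply/negP => lt2e.
  apply: (freeP m.+3 0%R).
  have memL (A : {set 'I_m.+3}) : #|A| < 3 -> A \in layers m.+3 0%R (e_poset P).
    move=> ltA; apply/bigcupP; exists (Ordinal (leq_trans ltA lt2e)) => //=.
    by rewrite inE add0r.
  pose i0 : 'I_m.+3 := ord0; pose i1 : 'I_m.+3 := inord 1.
  have i01 : i0 != i1 by rewrite -val_eqE /= inordK.
  have mem_above (A : {set 'I_m.+3}) : 0 < #|A| < 3 ->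
      A \in above (layers m.+3 0%R (e_poset P)) set0.
    by case/andP=> A_gt0 ltA; rewrite inE memL //= proper0 -card_gt0.
  apply: (@contains_fan _ _ m set0 [set i0] [set i0; i1]).
  - by rewrite memL ?cards0.
  - by rewrite mem_above ?cards1.
  - by rewrite mem_above ?cards2 ?i01.
  - by rewrite properEcard cards1 cards2 i01 sub1set set21.
  - rewrite addn3 -[leqLHS]card_ord -(card_imset _ (@set1_inj 'I_m.+3)).
    apply/subset_leq_card/subsetP => _ /imsetP[i _ ->].
    by rewrite mem_above ?cards1.
apply: maxP => n s /fan_contained[A [B [D []]]].
rewrite !inE => LA /andP[LB /proper_card ltAB] /andP[LD _] /proper_card ltBD _.
have sz X : X \in layers n s 2 -> exists2 i, i < 2 & Posz #|X| = (s + Posz i)%R.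
  by case/bigcupP=> i _; rewrite inE => /eqP szX; exists i.
have [[a lta ea] [b ltb eb] [d ltd ed]] := And3 (sz A LA) (sz B LB) (sz D LD).
lia.
Qed.

(** * A free family with Lubell function above 2 *)

Lemma sum_layer_bin n k : k <= n ->
  (\sum_(A : {set 'I_n} | #|A| == k) 'C(n, #|A|)%:R^-1 = 1 :> rat)%R.
Proof.
move=> le_kn; rewrite (eq_bigr (fun=> 'C(n, k)%:R^-1)%R); last by move=> A /eqP->.
rewrite sumr_const (_ : #|_| = 'C(n, k)); last first.
  by rewrite -[in RHS](card_ord n) -card_draws; apply: eq_card => A; rewrite !inE.
by rewrite -[LHS]mulr_natl mulfV // pnatr_eq0 -lt0n bin_gt0.
Qed.

(** With [n = 2m] the allowed sizes are [m - 1], [m] and [m + 1]; two full layers give exactly 2,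
    and [X] adds a positive term. *)
Lemma free_lubell_gt2 m : 0 < m ->
  exists F : {set {set 'I_(m.*2)}},
    [/\ poset_free (fan (3 :: nseq m.+1 2)) F,
        forall A, A \in F -> m.-1 <= #|A| <= m.*2 - m.-1 &
        (2%:R < lubell F)%R].
Proof.
move=> m_gt0; set n := m.*2.
have [X szX] : exists X : {set 'I_n}, #|X| = m.+1.
  have : 0 < #|[set X : {set 'I_n} | #|X| == m.+1]|.
    by rewrite card_draws card_ord bin_gt0 /n; lia.
  by case/card_gt0P=> X; rewrite inE => /eqP; exists X.
pose F := [set A : {set 'I_n} | [|| #|A| == m.-1, #|A| == m | A == X]].
have szF A : A \in F -> m.-1 <= #|A| <= m.+1.
  rewrite inE => /or3P[/eqP->|/eqP->|/eqP->]; rewrite ?szX; lia.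
exists F; split=> [|A /szF|]; last 2 first.
- by rewrite /n; lia.
- rewrite lubellE (bigD1 X) /=; last by rewrite inE eqxx !orbT.
  rewrite (bigID (fun A : {set 'I_n} => #|A| == m)) /=.
  set S1 := (X in (_ < _ + (X + _))%R); set S2 := (X in (_ < _ + (_ + X))%R).
  have -> : S1 = 1%R.
    rewrite -(@sum_layer_bin n m) /n; last lia.
    apply: eq_bigl => A; rewrite inE.
    case: (eqVneq #|A| m) => [szA|]; last by rewrite andbF.
    by rewrite orbT andbT /=; apply/eqP => eAX; move: szX; rewrite -eAX szA; lia.
  have -> : S2 = 1%R.
    rewrite -(@sum_layer_bin n m.-1) /n; last lia.
    apply: eq_bigl => A; rewrite inE; case: (eqVneq A X) => [->|_].
      by rewrite andbF szX; apply/esym/negbTE; lia.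
    by rewrite orbF andbT; case: eqP => [->|_]; rewrite ?andbN //=; lia.
  rewrite ltrDr invr_gt0 ltr0n bin_gt0 szX; lia.
case/fan_contained=> A [B [D [FA]]]; rewrite !inE.
case/andP=> _ /proper_card ltAB /andP[FD _] /proper_card ltBD.
(* A chain of three sets within three sizes starts at the lowest. *)
have szA : #|A| = m.-1.
  by have := szF A FA; have := szF D; rewrite inE => /(_ FD); lia.
rewrite leqNgt => /negP; apply.
(* A strict superset of [A] in [F] is [X] or [A] with one point added, which leaves at most
   [1 + (m + 1)] of them. *)
pose G := X |: [set x |: A | x in ~: A].
apply: (@leq_ltn_trans #|G|).
  apply/subset_leq_card/subsetP => E; rewrite !inE => /andP[FE pAE].
  have ltAE := proper_card pAE; rewrite szA in ltAE.
  case/or3P: FE => [/eqP eE|/eqP eE|->//]; first by rewrite eE ltnn in ltAE.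
  have /cards1P[x ex] : #|E :\: A| == 1.
    by rewrite cardsDS ?proper_sub // eE szA; lia.
  apply/orP; right; apply/imsetP; exists x.
    by have := set11 x; rewrite -ex !inE => /andP[].
  apply/setP => z; rewrite -ex !inE; case: (boolP (z \in A)) => [Az|_].
    by rewrite (subsetP (proper_sub pAE)).
  by rewrite orbF.
rewrite cardsU1.
have := leq_imset_card (fun x => x |: A) (~: A).
have := cardsC A; rewrite card_ord szA /n.
by have := leq_b1 (X \notin [set x |: A | x in ~: A]); lia.
Qed.

Theorem theorem5p3 (m : nat) (hm : (1 <= m)%N) :
  L_bounded (fan (3 :: nseq m.+1 2)) m /\
  ~ L_bounded (fan (3 :: nseq m.+1 2)) m.-1.
Proof.
split.
  move=> n F freeF szF; rewrite e_fan; apply: lubell_le2 freeF _ => // B /szF.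
  by case/andP.
move=> bounded; have [F [freeF szF lub]] := free_lubell_gt2 hm.
by have := bounded _ F freeF szF; rewrite e_fan leNgt lub.
Qed.
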